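(* Let $k\geq 3$ be an odd integer. For any coloring $\Delta\colon\mathbb{N}\to\mathbb{N}$ there is an infinite set $X=\{x_1<x_2<\cdots\}\subseteq\mathbb{N}$ such that, writing $X^{**}_{alt}=X^{**}_{alt}(k)=\{\sum^{**}_{j\in J}x_j : J\in\binom{\mathbb{N}}{k}\}$, the sets $X$ and $X^{**}_{alt}$ are colored according to one of the following patterns: (i) $X\cup X^{**}_{alt}$ is monochromatic; or (ii) $X\cup X^{**}_{alt}$ is rainbow; or (iii) $X$ is rainbow and $\Delta(\sum^{**}_{j\in J}x_j)=\Delta(x_{\max J})$ for all $J\in\binom{\mathbb{N}}{k}$. None of these three patterns may be omitted without violating the theorem, i.e., for each pattern there is a coloring $\Delta\colon\mathbb{N}\to\mathbb{N}$ such that no infinite $X\subseteq\mathbb{N}$ satisfies either of the other two patterns.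
   Context: $\mathbb{N}$ denotes the set of positive integers; $\binom{\mathbb{N}}{k}$ is the set of $k$-element subsets of $\mathbb{N}$. The elements of $X$ are indexed increasingly $x_1<x_2<\cdots$, and for odd $k$ and $J=\{j_1<j_2<\cdots<j_k\}$, $\sum^{**}_{j\in J}x_j=x_{j_k}-x_{j_{k-1}}+x_{j_{k-2}}-x_{j_{k-3}}+\cdots+x_{j_3}-x_{j_2}+x_{j_1}$. Monochromatic: all elements receive the same color; rainbow: all elements receive pairwise distinct colors. *)

(* Defs.v *)
From mathcomp Require Import all_boot all_order all_algebra finmap.
From mathcomp Require Import boolp classical_sets functions cardinality.

Set Implicit Arguments.
Unset Strict Implicit.
Unset Printing Implicit Defensive.

Local Open Scope classical_set_scope.
Local Open Scope nat_scope.

Definition posint : set nat := [set n | 0 < n].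

(* Maps N -> N with N the positive integers are represented by maps nat -> nat
   whose value at 0 is irrelevant. *)
Definition coloring (D : nat -> nat) : Prop := forall n, posint n -> posint (D n).

(* X = {x 1 < x 2 < ...}; the value x 0 is irrelevant. *)
Definition increasing_enum (x : nat -> nat) (X : set nat) : Prop :=
  (forall i j, 0 < i -> i < j -> x i < x j) /\ X = x @` posint.

Definition infinite_set_of_posint (X : set nat) : Prop :=
  X `<=` posint /\ infinite_set X.

Definition ksubsets (k : nat) : set {fset nat} :=
  [set J | [set` J] `<=` posint /\ #|` J| = k].

(* The subtractions are never truncated when s is decreasing; see altsumE. *)
Fixpoint altsum (s : seq nat) : nat :=
  match s with
  | [::] => 0
  | [:: a] => a
  | [:: a, b & s'] => (a - b) + altsum s'
  end.

Lemma altsumE (s : seq nat) : sorted gtn s ->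
  ((altsum s)%:Z = \sum_(i < size s) (-1) ^+ i * (nth 0%N s i)%:Z)%R.
Proof.
move: {2}(size s) (leqnn (size s)) => n; elim/ltn_ind: n s => n IHn.
case=> [|a [|b s]] /= sz_s.
- by rewrite big_ord0.
- by rewrite big_ord_recl big_ord0 /= GRing.expr0 GRing.mul1r GRing.addr0.
case/andP=> ltba sorted_s.
rewrite !big_ord_recl /= GRing.expr0 GRing.expr1 GRing.mul1r GRing.mulN1r.
rewrite GRing.addrA PoszD -subzn ?(ltnW ltba)//; congr (_ + _)%R.
rewrite (IHn (size s)) ?(path_sorted sorted_s) ?(ltnW sz_s) //.
by apply: eq_bigr => i _; rewrite !GRing.exprS !GRing.mulrA GRing.mulrNN !GRing.mul1r.
Qed.

(* x_{j_k} - x_{j_{k-1}} + ... - x_{j_2} + x_{j_1} for J = {j_1 < ... < j_k} *)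
Definition sumalt (x : nat -> nat) (J : {fset nat}) : nat :=
  altsum [seq x j | j <- sort geq J].

Definition Xalt (k : nat) (x : nat -> nat) : set nat :=
  sumalt x @` ksubsets k.

Definition monochromatic (D : nat -> nat) (A : set nat) : Prop :=
  exists c, forall a, A a -> D a = c.

Definition rainbow (D : nat -> nat) (A : set nat) : Prop :=
  forall a b, A a -> A b -> a <> b -> D a <> D b.

Definition pattern_mono (k : nat) (D : nat -> nat) (X : set nat)
    (x : nat -> nat) : Prop :=
  monochromatic D (X `|` Xalt k x).

Definition pattern_rainbow (k : nat) (D : nat -> nat) (X : set nat)
    (x : nat -> nat) : Prop :=
  rainbow D (X `|` Xalt k x).

Definition pattern_max (k : nat) (D : nat -> nat) (X : set nat)
    (x : nat -> nat) : Prop :=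
  rainbow D X /\
  forall J, ksubsets k J -> D (sumalt x J) = D (x (\max_(j <- J) j)).

(* Main.v *)
(** Let U be an idempotent ultrafilter on the natural numbers. Every property of
    a tuple (a, b, ...) holds for U-almost all a, U-almost all b, ... or fails
    so.  Look at two of them: D (a + b) = D a, and the agreement of
    y |-> D (a + y) and y |-> D (a + b + y) almost everywhere.  The sequence z
    is built greedily inside sets of U, and x_j = z_0 + ... + z_j; then the x_j
    and their alternating sums are sums of z over finite sets containing 0.
    If the first property holds, all these sums can be given one color.  If
    only the second holds, the color of a sum is determined, injectively, by
    its last index.  If both fail, each new z_n can be chosen so that all sums
    stay pairwise distinctly colored, also after any later extension. *)

Require Import Defs.
From mathcomp Require Import all_boot all_order all_algebra finmap.
From mathcomp Require Import boolp classical_sets functions cardinality filter.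
From mathcomp Require Import zify.

Set Implicit Arguments.
Unset Strict Implicit.
Unset Printing Implicit Defensive.

Local Open Scope classical_set_scope.
Local Open Scope nat_scope.

(** * Idempotent ultrafilters on the natural numbers *)

(** On ultrafilters this is the addition of the Stone-Cech compactification of the natural numbers;
    [F] governs the left summand. *)
Definition filter_add (F G : set_system nat) : set_system nat :=
  [set A | F [set x | G [set y | A (x + y)]]].

Lemma filter_addA (F G H : set_system nat) :
  filter_add F (filter_add G H) = filter_add (filter_add F G) H.
Proof.
rewrite /filter_add; apply/funext => A /=; congr F.
apply/funext => x /=; congr G; apply/funext => y /=; congr H.
by apply/funext => z /=; rewrite addnA.
Qed.

Lemma filter_add_sub (F F' G G' : set_system nat) : Filter F ->
  F `<=` F' -> G `<=` G' -> filter_add F G `<=` filter_add F' G'.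
Proof.
move=> FF FF' GG' A FGA; apply: FF'.
by move: FGA; apply: (@filterS _ F) => x; exact: GG'.
Qed.

Lemma filter_add_filter (F G : set_system nat) :
  Filter F -> Filter G -> Filter (filter_add F G).
Proof.
move=> FF FG; split.
- by apply: (@filterE _ F) => x; exact: filterT.
- by move=> A B; apply: (@filterS2 _ F) => x; exact: filterI.
- by move=> A B AB; apply: (@filterS _ F) => x; apply: filterS => y; exact: AB.
Qed.

Lemma filter_add_proper (F G : set_system nat) :
  ProperFilter F -> ProperFilter G -> ProperFilter (filter_add F G).
Proof.
move=> FF FG; apply: Build_ProperFilter; last exact: filter_add_filter.
by move=> /(@filter_ex _ F)[x /filter_ex[]].
Qed.

(** The inclusion is stable under unions of nonempty chains, as Zorn's lemma requires; for an
    ultrafilter it amounts to equality. Containing [\oo] rules out principal filters. *)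
Definition idempotent_filter (F : set_system nat) : Prop :=
  [/\ ProperFilter F, \oo `<=` F & F `<=` filter_add F F].

Lemma eventually_idempotent : idempotent_filter \oo.
Proof.
split; [exact: eventually_filter|by []|].
move=> A [n _ nA]; apply: (@filterE _ \oo) => x; exists n => // y /= ny.
by apply: nA => /=; lia.
Qed.

Lemma maximal_idempotent_filter : exists2 F, idempotent_filter F &
  forall G, idempotent_filter G -> F `<=` G -> G `<=` F.
Proof.
have [|F [PF maxF]] :=
    @Zorn_bigcup _ [set F : set_system nat | F = set0 \/ idempotent_filter F].
  move=> C CP totC.
  have [[F CF idF]|noC] := pselect (exists2 F, C F & idempotent_filter F); last first.
    left; apply/seteqP; split=> // A [F CF FA].
    case: (CP _ CF) => [F0|idF]; first by rewrite F0 in FA.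
    by case: noC; exists F.
  have idC G A : C G -> G A -> idempotent_filter G.
    by move=> CG GA; case: (CP _ CG) => // G0; rewrite G0 in GA.
  right; split.
  - apply: Build_ProperFilter.
      by move=> [G CG G0]; have [GP _ _] := idC _ _ CG G0; exact: filter_not_empty G0.
    case: (idF) => FP _ _; split.
    + by exists F => //; exact: filterT.
    + move=> A B [G CG GA] [H CH HB].
      have [GP _ _] := idC _ _ CG GA; have [HP _ _] := idC _ _ CH HB.
      have [GH|HG] := totC _ _ CG CH.
      * by exists H => //; apply: filterI => //; exact: GH.
      * by exists G => //; apply: filterI => //; exact: HG.
    + move=> A B AB [G CG GA]; exists G => //.
      by have [GP _ _] := idC _ _ CG GA; exact: filterS GA.
  - by case: idF => _ oF _ A /oF FA; exists F.
  - move=> A [G CG GA]; have [GP _ Gid] := idC _ _ CG GA.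
    exists G => //; have := Gid _ GA.
    by apply: (@filterS _ G) => x Gx; exists G.
have idF : idempotent_filter F.
  case: PF => // F0; exfalso; apply: (maxF \oo); last by right; exact: eventually_idempotent.
  rewrite F0; split=> // /(_ setT); apply; exact: filterT.
exists F => // G idG FG; apply: contrapT => nGF.
by apply: (maxF G) => //; right.
Qed.

(* The filter-theoretic form of the Ellis-Numakura argument: the filters F + U
   and the one generated by F and the sets {x | A - x in U}, A in U, are again
   idempotent, hence equal to F by maximality. *)
Lemma exists_idempotent_ultrafilter : exists U : set_system nat,
  [/\ UltraFilter U, \oo `<=` U & U `<=` filter_add U U].
Proof.
have [F [FP oF idF] maxF] := maximal_idempotent_filter.
have [U [UU FU]] := ultraFilterLemma FP.
have UP : ProperFilter U := @ultra_proper _ _ UU.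
exists U; split=> //; first exact: subset_trans FU.
have FFU : F `<=` filter_add F U.
  by apply: (subset_trans idF); exact: filter_add_sub.
(* F lies in F + F, hence in U + F, hence in F + (U + F); adding U on the right gives idempotence of
   F + U. *)
have FUF : filter_add F U `<=` F.
  apply: maxF => //; split.
  - exact: filter_add_proper.
  - exact: subset_trans FFU.
  - rewrite filter_addA; apply: filter_add_sub => //.
    rewrite -filter_addA; apply: (subset_trans idF); apply: filter_add_sub => //.
    by apply: (subset_trans idF); exact: filter_add_sub.
pose S (A : set nat) := [set x | U [set y | A (x + y)]].
pose B (EA : set nat * set nat) := EA.1 `&` S EA.2.
pose P := [set EA : set nat * set nat | F EA.1 /\ U EA.2].
have GF : Filter (filter_from P B).
  apply: filter_from_filter.
    by exists (setT, setT); split; exact: filterT.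
  move=> [E A] [E' A'] /= [FE UA] [FE' UA'].
  exists (E `&` E', A `&` A'); first by split; exact: filterI.
  move=> x /= [[Ex E'x]] SAA'; split; split=> //;
    by apply: filterS SAA' => y [].
have GP : ProperFilter (filter_from P B).
  apply: filter_from_proper => -[E A] /= [FE UA].
  (* If [E] misses [S A], then the complement of A - x is in U for every x in E, so the complement
     of A is in F + U, hence in F and in U. *)
  apply: contrapT => /set0P/negP/negPn/eqP ES0.
  have : U (~` A).
    apply/FU/FUF; apply: filterS FE => x Ex.
    have [Ux|//] := in_ultra_setVsetC [set y | A (x + y)] UU.
    by have : set0 x by rewrite -ES0.
  by move=> /(filterI UA); rewrite setICr => /filter_not_empty.
have FG : F `<=` filter_from P B.
  by move=> E FE; exists (E, setT); [split=> //; exact: filterT|move=> x []].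
have SG A : U A -> filter_from P B (S A).
  by move=> UA; exists (setT, A); [split=> //; exact: filterT|move=> x []].
have GsubF : filter_from P B `<=` F.
  apply: maxF => //; split=> //; first exact: subset_trans FG.
  move=> C [[E A] /= [FE UA] BC].
  rewrite /filter_add /mkset.
  (* A point y of both E - x and S (A - x) has x + y in both E and S A. *)
  apply: filterS (filterI (FG _ (idF _ FE : F _)) (SG _ UA)) => x [/= FEx UAx].
  apply: filterS (filterI (FG _ FEx) (SG _ UAx)) => y [Exy SAxy]; apply: BC.
  split=> //=; apply: filterS SAxy => z /=; by rewrite addnA.
by move=> A UA; exact/FU/GsubF/SG.
Qed.

Lemma ultra_not (T : Type) (U : set_system T) (P : set T) : UltraFilter U ->
  ~ U P -> U [set x | ~ P x].
Proof. by move=> UU nUP; have [] := in_ultra_setVsetC P UU. Qed.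

Lemma filter_forall_seq (T : Type) (I : eqType) (F : set_system T)
    (r : seq I) (P : I -> set T) : Filter F ->
  (forall i, i \in r -> F (P i)) -> F [set x | forall i, i \in r -> P i x].
Proof.
move=> FF; elim: r => [|j r IHr] FP; first exact: filterE.
have FPj : F (P j) by apply: FP; rewrite mem_head.
have FPr : F [set x | forall i, i \in r -> P i x].
  by apply: IHr => i ir; apply: FP; rewrite in_cons ir orbT.
apply: filterS2 FPj FPr => x Pjx Prx i; rewrite in_cons => /orP[/eqP->//|].
exact: Prx.
Qed.

(** Were [P] large, idempotence would give [m] and [m + b] in [P] for which [R] fails. Applied to
    equality of colors and of germs, this supplies fresh colors and fresh germs. *)
Lemma not_homogeneous (U : set_system nat) (R : nat -> nat -> Prop)
    (P : set nat) (a : nat) : ProperFilter U -> U `<=` filter_add U U ->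
  U [set m | U [set b | ~ R (a + m) (a + m + b)]] ->
  (forall m n, P m -> P n -> R (a + m) (a + n)) -> ~ U P.
Proof.
move=> UP idU UR PR UP0.
have [m [[Pm UPm] URm]] := filter_ex (filterI (filterI UP0 (idU _ UP0 : U _)) UR).
have [b [Pmb]] := filter_ex (filterI UPm URm).
by apply; rewrite -addnA; exact: PR.
Qed.

(** * Sums over initial segments *)

(* All sums of z over the subsets of {0, ..., n} that contain 0. *)
Fixpoint sums0 (z : nat -> nat) (n : nat) : seq nat :=
  if n is m.+1 then sums0 z m ++ [seq s + z m.+1 | s <- sums0 z m]
  else [:: z 0].

Definition psum (z : nat -> nat) (n : nat) : nat := \sum_(i < n.+1) z i.

Lemma psumS z n : psum z n.+1 = psum z n + z n.+1.
Proof. by rewrite /psum big_ord_recr. Qed.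

Lemma sums0_sub z m n : m <= n -> {subset sums0 z m <= sums0 z n}.
Proof.
elim: n => [|n IHn]; first by rewrite leqn0 => /eqP->.
rewrite leq_eqVlt => /orP[/eqP->//|/IHn mn] s /mn sn.
by rewrite mem_cat sn.
Qed.

Lemma sums0_add z n s : s \in sums0 z n -> s + z n.+1 \in sums0 z n.+1.
Proof. by move=> sn; rewrite mem_cat (map_f (addn^~ _)) ?orbT. Qed.

Lemma psum_sums0 z n : psum z n \in sums0 z n.
Proof.
elim: n => [|n IHn]; first by rewrite /psum big_ord1 mem_head.
by rewrite psumS sums0_add.
Qed.

Lemma psum_le z m n : m <= n -> psum z m <= psum z n.
Proof.
elim: n => [|n IHn]; first by rewrite leqn0 => /eqP->.
rewrite leq_eqVlt => /orP[/eqP->//|/IHn mn]; rewrite psumS; lia.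
Qed.

Lemma sums0_shift z m n s : m <= n -> s \in sums0 z m ->
  s + (psum z n - psum z m) \in sums0 z n.
Proof.
move=> mn sm; elim: n mn => [|n IHn].
  by rewrite leqn0 => /eqP m0; move: sm; rewrite m0 subnn addn0.
rewrite leq_eqVlt => /orP[/eqP<-|]; first by rewrite subnn addn0.
rewrite ltnS => mn.
have -> : s + (psum z n.+1 - psum z m) = s + (psum z n - psum z m) + z n.+1.
  by rewrite psumS; have := psum_le z mn; lia.
exact/sums0_add/IHn.
Qed.

(** Each difference of partial sums is a block of consecutive terms of [z], and the blocks are
    disjoint; the odd length leaves a last unpaired partial sum, which contributes [z 0]. The top
    term is split off because the color will depend on it. *)
Lemma altsum_sums0 z (s : seq nat) : sorted gtn s -> odd (size s) ->
  all (leq 1) s ->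
  exists2 t, t \in sums0 z (head 0 s).-1 &
             altsum [seq psum z j | j <- s] = t + z (head 0 s).
Proof.
have [n] := ubnP (size s); elim: n s => // n IHn [//|a [|b s]] /=.
  move=> _ _ _ /andP[a0 _]; exists (psum z a.-1); first exact: psum_sums0.
  by case: a a0 => // a _; rewrite psumS.
rewrite ltnS negbK => sz /andP[ba sbs] odds /and3P[a0 b0 s0].
have /IHn[] // : size s < n by lia.
  exact: path_sorted sbs.
move=> t tin ->.
have sb : head 0 s < b by case: s sbs odds {sz s0 tin} => //= c s /andP[].
have c0 : 0 < head 0 s by case: s s0 odds {sz sbs tin sb} => //= c s /andP[].
have {tin} tin : t + z (head 0 s) \in sums0 z b.
  apply: (@sums0_sub _ (head 0 s)); first lia.
  by move: tin; case: (head 0 s) c0 => //= c _; exact: sums0_add.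
(* The block from [b + 1] to [a] without its last term [z a]. *)
exists (t + z (head 0 s) + (psum z a.-1 - psum z b)).
  by apply: sums0_shift => //; lia.
have ba1 : b <= a.-1 by lia.
have := psum_le z ba1; case: a a0 {ba ba1 sz} => // a _ /=.
by rewrite psumS; lia.
Qed.

Lemma sort_ksubset k (J : {fset nat}) : ksubsets k J ->
  [/\ sorted gtn (sort geq J), size (sort geq J) = k,
      all (leq 1) (sort geq J) & head 0 (sort geq J) = \max_(j <- J) j].
Proof.
move=> [Jpos cardJ].
have geq_total : total geq by move=> m n; exact: leq_total.
have geq_trans : transitive geq by move=> m n p /= mn /leq_trans; exact.
have gt_sorted : sorted gtn (sort geq J).
  have : sorted geq (sort geq J) by exact: sort_sorted.
  have : uniq (sort geq J) by rewrite sort_uniq fset_uniq.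
  elim: (sort geq J) => //= a s IHs /andP[as_ us] ps.
  rewrite path_min_sorted ?IHs ?(path_sorted ps) //.
  apply/allP => b bs /=; rewrite ltn_neqAle.
  have /allP/(_ _ bs) /= -> := order_path_min geq_trans ps.
  by rewrite andbT; apply: contraNneq as_ => <-.
split=> //.
- by rewrite size_sort.
- by apply/allP => j; rewrite mem_sort => jJ; exact: Jpos.
- rewrite -(perm_big _ (permEl (perm_sort geq J))) /=.
  case: (sort geq J) gt_sorted => [|a s] /=; first by rewrite big_nil.
  move=> ps; rewrite big_cons; apply/esym/maxn_idPl/bigmax_leqP_seq => b bs _.
  have gtn_trans : transitive gtn by move=> m n p /= mn /ltn_trans; exact.
  exact/ltnW/(allP (order_path_min gtn_trans ps)).
Qed.

Lemma sumalt_sums0 z k (J : {fset nat}) : odd k -> ksubsets k J ->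
  let m := \max_(j <- J) j in
  0 < m /\ exists2 t, t \in sums0 z m.-1 & sumalt (psum z) J = t + z m.
Proof.
move=> oddk /sort_ksubset[sJ szJ posJ <-] /=.
have [|t tJ e] := altsum_sums0 z sJ _ posJ; first by rewrite szJ.
have m0 : 0 < head 0 (sort geq J).
  by case: (sort geq J) szJ posJ => [k0|a s _ /andP[]//]; rewrite -k0 in oddk.
by split=> //; exists t.
Qed.

Lemma psum_enum z : (forall n, 0 < z n.+1) ->
  infinite_set_of_posint (psum z @` posint) /\
  increasing_enum (psum z) (psum z @` posint).
Proof.
move=> zpos.
have incr i j : i < j -> psum z i < psum z j.
  move=> ij; apply: leq_trans (psum_le z ij).
  by rewrite psumS; have := zpos i; lia.
split; last by split=> // i j _; exact: incr.
split; first by move=> _ [[//|i] _ <-]; rewrite /posint /= psumS; have := zpos i; lia.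
have ge_id n : n <= psum z n by elim: n => // n IHn; have := incr n n.+1; lia.
move=> /finite_fsetP[B XB].
(* Since [psum z n] is at least [n], this element exceeds the maximum of [B]. *)
have : psum z (\max_(j <- B) j).+1 \in B.
  have : (psum z @` posint) (psum z (\max_(j <- B) j).+1) by exists (\max_(j <- B) j).+1.
  by rewrite XB.
move=> inB; have /= := @leq_bigmax_seq _ (B : seq nat) xpredT id _ inB isT.
by rewrite leqNgt ge_id.
Qed.

(** Greedy recursion on the list of sums formed so far: [I] is the invariant to be preserved, [T] a
    condition on the single new term. Only [I] must survive later extensions. *)
Lemma sums0_construction (U : set_system nat) (I : seq nat -> Prop)
    (T : seq nat -> nat -> Prop) (a : nat) :
  ProperFilter U -> \oo `<=` U -> I [:: a] ->
  (forall L, I L -> U [set z | I (L ++ [seq s + z | s <- L]) /\ T L z]) ->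
  exists z, [/\ z 0 = a, forall n, 0 < z n.+1, forall n, I (sums0 z n) &
                forall n, T (sums0 z n) (z n.+1)].
Proof.
move=> UP oU Ia IT.
have [L|f fP] := @choice _ _ (fun L z => I L ->
    [/\ 0 < z, I (L ++ [seq s + z | s <- L]) & T L z]).
  have [IL|] := pselect (I L); last by exists 0.
  have U0 : U [set z | 0 < z] by apply: oU; exists 1.
  by have [z [[ILz TLz] z0]] := filter_ex (filterI (IT _ IL) U0); exists z.
pose st n := iter n (fun L => L ++ [seq s + f L | s <- L]) [:: a].
pose z n := if n is m.+1 then f (st m) else a.
have zst n : sums0 z n = st n by elim: n => //= n ->.
have Ist n : I (st n) by elim: n => //= n /fP[].
by exists z; split=> // n; rewrite ?zst //; have [] := fP _ (Ist n).
Qed.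

(** * The trichotomy *)

(* [y |-> D (s + y)] and [y |-> D (t + y)] agree almost everywhere. *)
Definition same_germ (U : set_system nat) (D : nat -> nat) (s t : nat) : Prop :=
  U [set y | D (s + y) = D (t + y)].

Lemma same_germ_trans (U : set_system nat) D s t u : Filter U ->
  same_germ U D s t -> same_germ U D t u -> same_germ U D s u.
Proof. by move=> UF; apply: (@filterS2 _ U) => y /= -> ->. Qed.

Lemma same_germ_sym (U : set_system nat) D s t :
  same_germ U D s t -> same_germ U D t s.
Proof. by congr U; apply/funext => y; apply/propext; split. Qed.

(** The invariant says that each sum has the color of [a] and keeps it after adding almost any
    number; idempotence carries the second half over to the new sums. *)
Lemma sums0_monochromatic (U : set_system nat) (D : nat -> nat) :
  UltraFilter U -> \oo `<=` U -> U `<=` filter_add U U ->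
  U [set a | U [set b | D (a + b) = D a]] ->
  exists2 z, forall n, 0 < z n.+1 &
    exists c, forall n s, s \in sums0 z n -> D s = c.
Proof.
move=> UU oU idU Umin; have UP : ProperFilter U := @ultra_proper _ _ UU.
have [a Ua] := filter_ex Umin.
pose I (L : seq nat) := forall s, s \in L -> D s = D a /\ U [set y | D (s + y) = D a].
have [||z [_ zpos IZ _]] := @sums0_construction U I (fun _ _ => True) a UP oU.
- by move=> s; rewrite inE => /eqP->.
- move=> L IL.
  have UL s : s \in L ->
      U [set z | D (s + z) = D a /\ U [set y | D (s + z + y) = D a]].
    move=> /IL[_ Us]; apply: filterS2 Us (idU _ Us : U _) => z Dz Uz.
    by split=> //; apply: filterS Uz => y; rewrite /= -addnA.
  apply: filterS (filter_forall_seq _ UL) => z Uz; split=> // s.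
  by rewrite mem_cat => /orP[/IL//|/mapP[t tL ->]]; exact: Uz.
by exists z => //; exists (D a) => n s /IZ[].
Qed.

(** All sums keep the germ of [a], so almost every new term gives them a common color, and
    non-constancy lets that color avoid the finitely many old ones. *)
Lemma sums0_color_max (U : set_system nat) (D : nat -> nat) (a : nat) :
  UltraFilter U -> \oo `<=` U -> U `<=` filter_add U U ->
  U [set b | same_germ U D a (a + b)] ->
  (forall v, U [set m | D (a + m) <> v]) ->
  exists2 z, forall n, 0 < z n.+1 &
    forall n s, s \in sums0 z n ->
      D (s + z n.+1) = D (z 0 + z n.+1) /\ D s <> D (z 0 + z n.+1).
Proof.
move=> UU oU idU Ua nconst; have UP : ProperFilter U := @ultra_proper _ _ UU.
pose I (L : seq nat) := forall s, s \in L -> same_germ U D s a.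
pose T (L : seq nat) z := forall s, s \in L -> D (s + z) = D (a + z) /\ D s <> D (a + z).
have [||z [za zpos _ Tz]] := @sums0_construction U I T a UP oU.
- by move=> s; rewrite inE => /eqP->; exact: filterE.
- move=> L IL.
  have UL s : s \in L -> U [set z | same_germ U D (s + z) a /\
      (D (s + z) = D (a + z) /\ D s <> D (a + z))].
    move=> /IL Us; apply: filterS3 (filterI Us (idU _ Us : U _)) Ua (nconst (D s)).
    move=> z [Dz Uz] Uaz nDz; split; last by split=> //; exact: nesym.
    (* By idempotence [s + z] and [a + z] have the same germ; by the choice of [a], the latter has
       the germ of [a]. *)
    apply: (@same_germ_trans U D _ (a + z)) (same_germ_sym Uaz).
    by rewrite /same_germ; apply: filterS Uz => y; rewrite /= !addnA.
  apply: filterS (filter_forall_seq _ UL) => z Uz; split.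
    by move=> s; rewrite mem_cat => /orP[/IL//|/mapP[t /Uz[? _] ->]].
  by move=> s /Uz[].
by exists z => // n s; rewrite za; exact: Tz.
Qed.

(** Distinct colors alone would not survive: [s + z] and [t + z] share the new term, so the
    invariant also keeps the germs of distinct sums distinct. *)
Lemma sums0_rainbow (U : set_system nat) (D : nat -> nat) :
  UltraFilter U -> \oo `<=` U -> U `<=` filter_add U U ->
  U [set a | U [set b | D (a + b) <> D a]] ->
  U [set a | U [set b | ~ same_germ U D a (a + b)]] ->
  exists2 z, forall n, 0 < z n.+1 &
    forall n s t, s \in sums0 z n -> t \in sums0 z n -> s <> t -> D s <> D t.
Proof.
move=> UU oU idU U1 U2; have UP : ProperFilter U := @ultra_proper _ _ UU.
pose W := [set a | U [set b | D (a + b) <> D a] /\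
                   U [set b | ~ same_germ U D a (a + b)]].
have UW : U W by exact: filterI.
have Dnew s v : U [set m | W (s + m)] -> U [set m | D (s + m) <> v].
  move=> Us; apply: ultra_not.
  apply: (@not_homogeneous U (fun x y => D y = D x) _ s) => //; last by move=> m n -> ->.
  by apply: filterS Us => m [].
have germ_new s t : U [set m | W (s + m)] ->
    U [set m | ~ same_germ U D (s + m) t].
  move=> Us; apply: ultra_not.
  apply: (@not_homogeneous U (same_germ U D) _ s) => //.
    by apply: filterS Us => m [].
  by move=> m n mt nt; apply: same_germ_trans mt (same_germ_sym nt).
(* The invariant needs [a + m] in [W] for almost all [m], rather than [a] itself in [W]. *)
have [a Ua] := filter_ex (idU _ UW : U _).
pose I (L : seq nat) := (forall s, s \in L -> U [set m | W (s + m)]) /\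
  forall s t, s \in L -> t \in L -> s <> t -> D s <> D t /\ ~ same_germ U D s t.
have [||z [_ zpos IZ _]] := @sums0_construction U I (fun _ _ => True) a UP oU.
- split=> [s|s t]; first by rewrite inE => /eqP->.
  by rewrite !inE => /eqP-> /eqP->.
- move=> L [WL IL].
  have UL s : s \in L -> U [set z | U [set m | W (s + z + m)]].
    move=> /WL Us; apply: filterS (idU _ Us : U _) => z.
    by apply: filterS => y; rewrite /= addnA.
  have UN s : s \in L -> U [set z | forall t, t \in L ->
      [/\ D (s + z) <> D t, ~ same_germ U D (s + z) t &
          s <> t -> D (s + z) <> D (t + z) /\
                    ~ same_germ U D (s + z) (t + z)]].
    move=> sL; apply: filter_forall_seq => t tL.
    have Ust : U [set z | s <> t -> D (s + z) <> D (t + z) /\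
                    ~ same_germ U D (s + z) (t + z)].
      have [->|/eqP st] := eqVneq s t; first exact: filterE.
      (* In an ultrafilter, different germs disagree almost everywhere; this separates the colors of
         [s + z] and [t + z], and with idempotence also their germs. *)
      have [_ /(ultra_not UU) Ust] := IL _ _ sL tL st.
      apply: filterS2 Ust (idU _ Ust : U _) => z Dz Uz _; split=> // Gz.
      by have [y [/= nDy]] := filter_ex (filterI Uz Gz); rewrite -!addnA.
    by apply: filterS3 (Dnew _ (D t) (WL _ sL)) (germ_new _ t (WL _ sL)) Ust.
  apply: filterS2 (filter_forall_seq _ UL) (filter_forall_seq _ UN) => z Wz Nz.
  split=> //; split=> [s|s t].
    by rewrite mem_cat => /orP[/WL//|/mapP[r rL ->]]; exact: Wz.
  rewrite !mem_cat => /orP[sL|/mapP[s' sL ->]] /orP[tL|/mapP[t' tL ->]] st.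
  + exact: IL.
  + have [Dn Gn _] := Nz _ tL _ sL; split; first exact: nesym.
    by move=> /same_germ_sym.
  + by have [] := Nz _ sL _ tL.
  + have [_ _] := Nz _ sL _ tL; apply; by move=> e; apply: st; rewrite e.
by exists z => // n s t sn tn st; have [_ /(_ s t sn tn st)[]] := IZ n.
Qed.

Lemma canonical_pattern (k : nat) (D : nat -> nat) : odd k ->
  exists (X : set nat) (x : nat -> nat),
    [/\ infinite_set_of_posint X, increasing_enum x X &
        [\/ pattern_mono k D X x, pattern_rainbow k D X x
          | pattern_max k D X x]].
Proof.
move=> oddk; have [U [UU oU idU]] := exists_idempotent_ultrafilter.
have UP : ProperFilter U := @ultra_proper _ _ UU.
have inX z a : ((psum z @` posint) `|` Xalt k (psum z)) a ->
    exists n, a \in sums0 z n.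
  case=> [[n _ <-]|[J kJ <-]]; first by exists n; exact: psum_sums0.
  have [m0 [t tin ->]] := sumalt_sums0 z oddk kJ.
  exists (\max_(j <- J) j); move: tin.
  by case: (\max_(j <- J) j) m0 => // m _; exact: sums0_add.
suff [z zpos patz] : exists2 z, forall n, 0 < z n.+1 &
    [\/ pattern_mono k D (psum z @` posint) (psum z),
        pattern_rainbow k D (psum z @` posint) (psum z)
      | pattern_max k D (psum z @` posint) (psum z)].
  by have [? ?] := psum_enum zpos; exists (psum z @` posint), (psum z).
have [Umin|nUmin] := pselect (U [set a | U [set b | D (a + b) = D a]]).
  have [z zpos [c zc]] := sums0_monochromatic UU oU idU Umin.
  by exists z => //; apply: Or31; exists c => a /inX[n]; exact: zc.
have {}nUmin : U [set a | U [set b | D (a + b) <> D a]].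
  by apply: filterS (ultra_not UU nUmin) => a; exact: ultra_not.
have [Umid|nUmid] := pselect (U [set a | U [set b | same_germ U D a (a + b)]]).
  (* Idempotence moves the failure of the first property to [a + m], which prevents the color of
     [a + m] from being constant almost everywhere. *)
  have [a [Ua Wa]] := filter_ex (filterI Umid (idU _ nUmin : U _)).
  have nconst v : U [set m | D (a + m) <> v].
    apply: ultra_not.
    by apply: (@not_homogeneous U (fun x y => D y = D x) _ a) => // m n -> ->.
  have [z zpos zP] := sums0_color_max UU oU idU Ua nconst.
  exists z => //; apply: Or33.
  have Dpsum m : D (psum z m.+1) = D (z 0 + z m.+1).
    by rewrite psumS; have [] := zP _ _ (psum_sums0 z m).
  have rb i j : i < j -> D (psum z i) <> D (psum z j).
    case: j => // j ij; rewrite Dpsum.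
    by have [] := zP _ _ (@sums0_sub z i j ij _ (psum_sums0 z i)).
  split=> [_ _ [i _ <-] [j _ <-] ij|J kJ].
    have [/rb//|/rb/nesym//|e] := ltngtP i j; by rewrite e in ij.
  have [m0 [t tin ->]] := sumalt_sums0 z oddk kJ.
  move: tin; case: (\max_(j <- J) j) m0 => // m _ tin.
  (* [t] and [psum z m] both lie in [sums0 z m], so adding [z m.+1] gives them the same color. *)
  by rewrite Dpsum; have [] := zP _ _ tin.
have {}nUmid : U [set a | U [set b | ~ same_germ U D a (a + b)]].
  by apply: filterS (ultra_not UU nUmid) => a; exact: ultra_not.
have [z zpos zP] := sums0_rainbow UU oU idU nUmin nUmid.
exists z => //; apply: Or32 => a b /inX[m am] /inX[n bn].
by apply: (zP (maxn m n)); [apply: sums0_sub am|apply: sums0_sub bn]; lia.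
Qed.

(** * Necessity of the three patterns *)

(** In x_c - x_d + rest, induction bounds the rest by x_d, so the whole is below x_c, hence below
    x_b. *)
Lemma altsum_lt (x : nat -> nat) (b : nat) (t : seq nat) :
  (forall i, 0 < i -> 0 < x i) -> (forall i j, 0 < i -> i < j -> x i < x j) ->
  sorted gtn (b :: t) -> all (leq 1) (b :: t) ->
  altsum [seq x j | j <- t] < x b.
Proof.
move=> xpos xincr; have [n] := ubnP (size t).
elim: n b t => // n IHn b [|c [|d t]] /=.
- by move=> _ _ /andP[/xpos].
- by move=> _ /andP[cb _] /and3P[_ c0 _]; exact: xincr.
rewrite ltnS => sz /and3P[cb dc pt] /and4P[_ c0 d0 t0].
have lt_d : altsum [seq x j | j <- t] < x d.
  by apply: IHn => /=; rewrite ?pt ?d0 //; lia.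
have := xincr _ _ d0 dc; have := xincr _ _ c0 cb; lia.
Qed.

Lemma sorted_rev_iota (b m : nat) : m < b -> sorted gtn (b :: rev (iota 1 m)).
Proof.
move=> mb /=; rewrite path_sortedE; last by move=> ? ? ? /= ? /ltn_trans; exact.
rewrite rev_sorted iota_ltn_sorted andbT.
by apply/allP => j; rewrite mem_rev mem_iota /=; lia.
Qed.

Lemma altsum_rev_iota_lt (x : nat -> nat) (b m : nat) :
  (forall i, 0 < i -> 0 < x i) -> (forall i j, 0 < i -> i < j -> x i < x j) ->
  m < b -> altsum [seq x j | j <- rev (iota 1 m)] < x b.
Proof.
move=> xpos xincr mb; apply: altsum_lt => //; first exact: sorted_rev_iota.
by apply/allP => j; rewrite inE mem_rev mem_iota /=; lia.
Qed.

(** The test set is {1, ..., k-2, b, n}: varying [b] changes the alternating sum while the maximum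
    and the tail stay fixed. *)
Lemma ksubset_two_largest (x : nat -> nat) (k b n : nat) :
  3 <= k -> k - 2 < b -> b < n ->
  exists J, [/\ ksubsets k J, \max_(j <- J) j = n & sumalt x J =
    x n - x b + altsum [seq x j | j <- rev (iota 1 (k - 2))]].
Proof.
move=> k3 kb bn; set s := [:: n, b & rev (iota 1 (k - 2))].
have sorted_s : sorted gtn s.
  by apply/andP; split=> //; exact: sorted_rev_iota.
have uniq_s : uniq s.
  by apply: sorted_uniq sorted_s => [? ? ? /= ? /ltn_trans|?]; [exact|exact: ltnn].
pose J := [fset j in s]%fset.
have perm_J : perm_eq J s.
  by apply: uniq_perm; rewrite ?fset_uniq // => j; rewrite !inE.
have kJ : ksubsets k J.
  split; last by rewrite (perm_size perm_J) /= size_rev size_iota; lia.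
  by move=> j /=; rewrite (perm_mem perm_J) !inE mem_rev mem_iota /posint /=; lia.
have sortJ : sort geq J = s.
  have [sJ _ _ _] := sort_ksubset kJ.
  apply: (@sorted_eq _ gtn) => //.
  - by move=> ? ? ? /= ? /ltn_trans; exact.
  - by move=> i j /=; lia.
  - by rewrite (permPl (permEl (perm_sort geq J))).
have [_ _ _ maxJ] := sort_ksubset kJ.
by exists J; rewrite -maxJ /sumalt sortJ.
Qed.

Lemma enum_pos X x : infinite_set_of_posint X -> increasing_enum x X ->
  forall i, 0 < i -> 0 < x i.
Proof. by move=> [Xpos _] [_ Xx] i i0; apply: Xpos; rewrite Xx; exists i. Qed.

Lemma enum_mem X x i : increasing_enum x X -> 0 < i -> X (x i).
Proof. by move=> [_ ->] i0; exists i. Qed.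

Lemma enum_add_le X x i m : increasing_enum x X -> 0 < i ->
  x i + m <= x (i + m).
Proof.
move=> [xincr _] i0; elim: m => [|m IHm]; first by rewrite !addn0.
have := xincr (i + m) (i + m.+1); lia.
Qed.

(** The color is the binary length. An infinite set contains numbers of different lengths, while
    three numbers within a factor of two of each other cannot have three different lengths. *)
Lemma trunc_log_not_mono_rainbow (k : nat) (X : set nat) (x : nat -> nat) : 3 <= k ->
  infinite_set_of_posint X -> increasing_enum x X ->
  ~ (pattern_mono k (fun n => (trunc_log 2 n).+1) X x \/
     pattern_rainbow k (fun n => (trunc_log 2 n).+1) X x).
Proof.
move=> k3 Xpos enumX; have xpos := enum_pos Xpos enumX.
have [xincr _] := (enumX); case=> [[c Dc]|rainbowX].
  have := Dc (x (1 + x 1)) (or_introl (enum_mem enumX (isT : 0 < 1 + x 1))).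
  rewrite -(Dc (x 1) (or_introl (enum_mem enumX (isT : 0 < 1)))) => -[].
  have /(leq_trunc_log 2) := enum_add_le (x 1) enumX (isT : 0 < 1).
  by rewrite addnn trunc_log2_double ?xpos //; lia.
(* This index makes x_n at least 2 x_k, so the sums [A] and [B] formed below with second largest
   index [k.-1] and [k] satisfy x_n / 2 <= B < A < x_n. *)
set n := k + x k.
have k0 : 0 < k by lia.
have xn : x k + x k <= x n by exact: enum_add_le enumX k0.
have lt_kn : k < n by have := xpos _ k0; lia.
set C := altsum [seq x j | j <- rev (iota 1 (k - 2))].
have [JA [kA _ sA]] : exists J, [/\ ksubsets k J, \max_(j <- J) j = n &
    sumalt x J = x n - x k.-1 + C] by apply: ksubset_two_largest; lia.
have [JB [kB _ sB]] : exists J, [/\ ksubsets k J, \max_(j <- J) j = n &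
    sumalt x J = x n - x k + C] by apply: ksubset_two_largest; lia.
have ltC : C < x k.-1 by apply: altsum_rev_iota_lt => //; lia.
have ltk : x k.-1 < x k by apply: xincr; lia.
have Xn : (X `|` Xalt k x) (x n) by left; apply: enum_mem enumX _; lia.
have XA : (X `|` Xalt k x) (x n - x k.-1 + C) by right; exists JA.
have XB : (X `|` Xalt k x) (x n - x k + C) by right; exists JB.
have := rainbowX _ _ Xn XA; have := rainbowX _ _ XA XB.
have := rainbowX _ _ Xn XB.
set A := _ - _ + _ in XA *; set B := _ - _ + _ in XB *.
have lA : trunc_log 2 A <= trunc_log 2 (x n) by apply: leq_trunc_log; lia.
have lB : trunc_log 2 B <= trunc_log 2 A by apply: leq_trunc_log; lia.
have ln : trunc_log 2 (x n) <= (trunc_log 2 B).+1.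
  by rewrite -trunc_log2_double; [apply: leq_trunc_log; lia|lia].
lia.
Qed.

Lemma id_not_mono_max (k : nat) (X : set nat) (x : nat -> nat) : 3 <= k ->
  infinite_set_of_posint X -> increasing_enum x X ->
  ~ (pattern_mono k id X x \/ pattern_max k id X x).
Proof.
move=> k3 Xpos enumX; have xpos := enum_pos Xpos enumX.
have [xincr _] := (enumX); case=> [[c Dc]|[_ maxX]].
  have := Dc (x 2) (or_introl (enum_mem enumX (isT : 0 < 2))).
  rewrite -(Dc (x 1) (or_introl (enum_mem enumX (isT : 0 < 1)))) /=.
  by have := xincr 1 2; lia.
(* For J = {1, ..., k} the alternating sum is strictly below x_k, so the identity separates them. *)
have [|||J [kJ maxJ sJ]] := @ksubset_two_largest x k k.-1 k; [lia..|].
have := maxX _ kJ; rewrite maxJ sJ /=.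
have : x k.-1 < x k by apply: xincr; lia.
have : altsum [seq x j | j <- rev (iota 1 (k - 2))] < x k.-1.
  by apply: altsum_rev_iota_lt => //; lia.
lia.
Qed.

Lemma const_not_rainbow_max (k c : nat) (X : set nat) (x : nat -> nat) :
  increasing_enum x X ->
  ~ (pattern_rainbow k (fun=> c) X x \/ pattern_max k (fun=> c) X x).
Proof.
move=> enumX; have [xincr _] := (enumX).
have X1 := enum_mem enumX (isT : 0 < 1).
have X2 := enum_mem enumX (isT : 0 < 2).
have x12 : x 1 <> x 2 by have := xincr 1 2 isT isT; lia.
by case=> [rainbowX|[rainbowX _]];
  [apply: (rainbowX (x 1) (x 2)); [left|left|..]|apply: (rainbowX (x 1) (x 2))].
Qed.

Theorem theorem5p1 (k : nat) (k_ge3 : 3 <= k) (k_odd : odd k) :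
  (forall D : nat -> nat, coloring D ->
     exists (X : set nat) (x : nat -> nat),
       [/\ infinite_set_of_posint X, increasing_enum x X &
           [\/ pattern_mono k D X x, pattern_rainbow k D X x
             | pattern_max k D X x]]) /\
  [/\ exists D : nat -> nat, coloring D /\
        forall (X : set nat) (x : nat -> nat),
          infinite_set_of_posint X -> increasing_enum x X ->
          ~ (pattern_rainbow k D X x \/ pattern_max k D X x),
      exists D : nat -> nat, coloring D /\
        forall (X : set nat) (x : nat -> nat),
          infinite_set_of_posint X -> increasing_enum x X ->
          ~ (pattern_mono k D X x \/ pattern_max k D X x)
    & exists D : nat -> nat, coloring D /\
        forall (X : set nat) (x : nat -> nat),
          infinite_set_of_posint X -> increasing_enum x X ->
          ~ (pattern_mono k D X x \/ pattern_rainbow k D X x)].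
Proof.
split=> [D _|]; first exact: canonical_pattern.
split.
- by exists (fun=> 1); split=> // X x _; exact: const_not_rainbow_max.
- by exists id; split=> // X x; exact: id_not_mono_max.
(* The successor keeps the color of 1 positive. *)
- exists (fun n => (trunc_log 2 n).+1); split=> // X x.
  exact: trunc_log_not_mono_rainbow.
Qed.
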